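(* Let $q$ be a power of a prime $p$ and let $n$ be a positive integer such that $p$ does not divide $n^2-n+1$. The Hurwitz curve $\mathcal X_n$, i.e. the non-singular plane curve of equation $$X^nY+Y^nZ+Z^nX=0,$$ is $\mathbf F_{q^2}$-maximal if and only if $$q+1\equiv 0\pmod{(n^2-n+1)}.$$
   Context: An $\mathbf F_{q^2}$-maximal curve of genus $g$ is a projective, geometrically irreducible, non-singular algebraic curve defined over $\mathbf F_{q^2}$ whose number of $\mathbf F_{q^2}$-rational points equals $1+q^2+2qg$. *)

(* Defs.v *)
From HB Require Import structures.
From mathcomp Require Export all_boot all_order all_algebra all_field.
From mathcomp.multinomials Require Export mpoly.

Set Implicit Arguments.
Unset Strict Implicit.
Unset Printing Implicit Defensive.

Import GRing.Theory.
Local Open Scope ring_scope.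

(* A projective plane curve over a field K is given by a form F in K[X, Y, Z];
   the coordinates X, Y, Z are 'X_0, 'X_1, 'X_2. *)

Definition irreducible_mpoly (L : fieldType) (F : {mpoly L[3]}) : Prop :=
  [/\ F != 0, F \isn't a GRing.unit
    & forall G H : {mpoly L[3]}, F = G * H ->
        G \is a GRing.unit \/ H \is a GRing.unit].

Definition geometrically_irreducible (K : fieldType) (F : {mpoly K[3]}) :
    Prop :=
  forall (L : fieldType) (f : {rmorphism K -> L}),
    irreducible_mpoly (map_mpoly f F).

(* No geometric point of the curve is singular: a point of the projective plane
   over an extension L is represented by a nonzero v. *)
Definition nonsingular (K : fieldType) (F : {mpoly K[3]}) : Prop :=
  forall (L : fieldType) (f : {rmorphism K -> L}) (v : 'rV[L]_3),
    v != 0 -> (map_mpoly f F).@[v 0] = 0 ->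
    exists i : 'I_3, ((map_mpoly f F)^`M(i)).@[v 0] != 0.

(* A K-rational point of the projective plane is the line K v of K^3 spanned by
   a nonzero vector v, here the finite set of its elements. *)
Definition rational_points (K : finFieldType) (F : {mpoly K[3]}) :
    {set {set 'rV[K]_3}} :=
  [set [set a *: v | a : K] | v : 'rV[K]_3 & (v != 0) && (F.@[v 0] == 0)].

(* r is the dimension of the degree d part of K[X, Y, Z] / (F); V is the degree
   d part of the ideal (F). *)
Definition hilbert_value (K : fieldType) (F : {mpoly K[3]}) (d r : nat) :
    Prop :=
  exists2 V : {vspace dhomog 3 K d},
    forall G : dhomog 3 K d,
      G \in V <-> exists H : {mpoly K[3]}, mpoly_of_dhomog G = H * F
    & (r + \dim V)%N = \dim {: dhomog 3 K d}.

Definition hilbert_polynomial (K : fieldType) (F : {mpoly K[3]})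
    (P : {poly rat}) : Prop :=
  exists d0 : nat, forall d : nat, (d0 <= d)%N ->
    exists2 r : nat, hilbert_value F d r & r%:R = P.[d%:R].

(* The genus of a non-singular projective curve, as the arithmetic genus
   1 - P(0) with P the Hilbert polynomial of the curve. *)
Definition has_genus (K : fieldType) (F : {mpoly K[3]}) (g : nat) : Prop :=
  exists2 P : {poly rat}, hilbert_polynomial F P & g%:R = 1 - P.[0].

(* To be used with #|K| = q ^ 2. *)
Definition maximal_curve (q : nat) (K : finFieldType) (F : {mpoly K[3]}) :
    Prop :=
  [/\ exists d : nat, F \is d.-homog,
      geometrically_irreducible F,
      nonsingular F
    & exists2 g : nat, has_genus F g
        & #|rational_points F| = (1 + q ^ 2 + 2 * q * g)%N].

Definition hurwitz (K : fieldType) (n : nat) : {mpoly K[3]} :=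
  'X_0 ^+ n * 'X_1 + 'X_1 ^+ n * 'X_2 + 'X_2 ^+ n * 'X_0.

(* Main.v *)
(* Write m = n^2 - n + 1 and r = n - 1.  Off the three coordinate points, the
   Hurwitz curve is birational to y^m = (1 + b) b^r over the line minus
   {0, -1, oo}: it is the pull-back of the line X + Y + Z = 0 under a monomial
   map whose kernel is cyclic of order m.  Hence the number of points over
   F_(q^2) is 3 + d N0, where d = gcd(m, q^2 - 1) and N0 counts the b whose
   monomial (1 + b) b^r is a d-th power.
   Counting collisions of the class of (1 + b) b^r modulo d-th powers amounts to
   counting pairs of roots of unity, and Cauchy-Schwarz then gives
   (d N0 - (q^2 - 2))^2 <= (d - 1)^2 q^2: this replaces the purity of Jacobi
   sums.  A maximal curve therefore has d = m, and reducing its number of points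
   modulo m gives m | q^2 - q - 2, so m | q + 1.
   If conversely m | q + 1, a point t of the line outside F_q is the same as the
   pair (1 + t)^(q-1), t^(q-1) of distinct norm-one elements other than 1, and
   N0 is given by the same count of pairs of roots of unity. *)
From HB Require Import structures.
Require Import Defs.
From mathcomp Require Import cyclic zify ring.

Set Implicit Arguments.
Unset Strict Implicit.
Unset Printing Implicit Defensive.

(** * Counting with roots of unity *)

Section Collisions.
Local Open Scope nat_scope.

Lemma sqr_sum_leq (T : finType) (S : {set T}) (x : T -> nat) :
  (\sum_(i in S) x i) ^ 2 <= #|S| * \sum_(i in S) x i ^ 2.
Proof.
have E : \sum_(i in S) \sum_(j in S) 2 * (x i * x j)
         <= \sum_(i in S) \sum_(j in S) (x i ^ 2 + x j ^ 2).
  by apply: leq_sum => i _; apply: leq_sum => j _; apply: nat_Cauchy.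
suff [H1 H2] :
  \sum_(i in S) \sum_(j in S) 2 * (x i * x j) = 2 * (\sum_(i in S) x i) ^ 2 /\
  \sum_(i in S) \sum_(j in S) (x i ^ 2 + x j ^ 2)
    = 2 * (#|S| * \sum_(i in S) x i ^ 2).
  by move: E; rewrite H1 H2 leq_pmul2l.
split.
  rewrite -mulnn big_distrl big_distrr /=; apply: eq_bigr => i _.
  by rewrite !big_distrr.
under eq_bigr => i _ do rewrite big_split sum_nat_const.
by rewrite big_split /= sum_nat_const -big_distrr /= mul2n addnn.
Qed.

(** Collisions number the sum of the squared fibre sizes. The fibre over [c] is split off and
    Cauchy-Schwarz is applied to the other [#|S|.-1] fibres, whose sizes add up to the
    truncation-free difference on the left. *)
Lemma sqr_collisions (I T : finType) (D : {set I}) (g : I -> T) (S : {set T})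
    (c : T) :
  {in D, forall i, g i \in S} -> c \in S ->
  (#|D| - #|[set i in D | g i == c]|) ^ 2
      + #|S|.-1 * #|[set i in D | g i == c]| ^ 2
    <= #|S|.-1 * #|[set x in setX D D | g x.1 == g x.2]|.
Proof.
move=> gS cS; pose N e := #|[set i in D | g i == e]|.
have ND : #|D| = \sum_(e in S) N e.
  rewrite -sum1_card (partition_big g (mem S)) //=; apply: eq_bigr => e _.
  by rewrite sum1dep_card.
have NE : #|[set x in setX D D | g x.1 == g x.2]| = \sum_(e in S) N e ^ 2.
  rewrite -sum1_card (partition_big (fun x => g x.1) (mem S)) /=; last first.
    by move=> x; rewrite !inE => /andP[/andP[/gS]].
  apply: eq_bigr => e _; rewrite sum1dep_card -mulnn -cardsX.
  apply: eq_card => -[i j]; rewrite !inE /=.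
  case: (i \in D) (j \in D) => [] [] //=; rewrite ?andbF //.
  by case: (g i =P e) => [->|]; rewrite ?andbF ?andbT //= eq_sym.
rewrite ND NE (bigD1 c) //= [in leqRHS](bigD1 c) //= -/(N c) addKn mulnDr.
rewrite addnC leq_add2l.
have Sc (F : T -> nat) : \sum_(i in S | i != c) F i = \sum_(i in S :\ c) F i.
  by apply: eq_bigl => i; rewrite !inE andbC.
by rewrite !Sc (leq_trans (sqr_sum_leq _ _)) // (cardsD1 c S) cS.
Qed.

End Collisions.

(** * Roots of unity and power residues in a finite field *)

Section RootsOfUnity.
Import GRing.Theory.
Local Open Scope ring_scope.

Lemma card_finField_pred_gt0 (K : finFieldType) : (0 < #|K|.-1)%N.
Proof. by have := finNzRing_gt1 K; case: #|K| => [|[]]. Qed.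

Lemma expf_card_pred (K : finFieldType) (x : K) :
  (x ^+ #|K|.-1 == 1) = (x != 0).
Proof.
have K1 := card_finField_pred_gt0 K.
case: (eqVneq x 0) => [->|x0].
  by rewrite expr0n gtn_eqF // eq_sym oner_eq0.
apply/eqP/(mulfI x0); rewrite -exprS prednK ?expf_card ?mulr1 //.
by rewrite ltnW // finNzRing_gt1.
Qed.

Lemma finField_prim_root (K : finFieldType) :
  exists z : K, (#|K|.-1).-primitive_root z.
Proof.
have /hasP[z _ zP] : has (#|K|.-1).-primitive_root (enum [set~ (0 : K)]).
  apply: has_prim_root; rewrite ?enum_uniq ?card_finField_pred_gt0 //.
    by apply/allP => x; rewrite mem_enum !inE unity_rootE expf_card_pred.
  by rewrite -cardE cardsC1.
by exists z.
Qed.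

Lemma card_unity_roots (K : finFieldType) (j : nat) :
  (j %| #|K|.-1)%N -> #|[set x : K | x ^+ j == 1]| = j.
Proof.
have [z zP] := finField_prim_root K => /(dvdn_prim_root zP) wP.
set w := z ^+ _ in wP.
have -> : [set x : K | x ^+ j == 1] = [set w ^+ (i : 'I_j) | i : 'I_j].
  apply/setP => x; rewrite inE; apply/eqP/imsetP => [/(prim_rootP wP)[i ->]|[i _ ->]].
    by exists i.
  by rewrite exprAC (prim_expr_order wP) expr1n.
rewrite card_imset ?card_ord // => a b /eqP.
by rewrite (eq_prim_root_expr wP) !modn_small // => /eqP/val_inj.
Qed.

Lemma expr_gcd_eq1 (R : nzRingType) (x : R) (a b : nat) :
  x ^+ a = 1 -> x ^+ b = 1 -> x ^+ gcdn a b = 1.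
Proof.
case: (posnP a) => [->|a0 xa xb]; first by rewrite gcd0n.
case: (egcdnP b a0) => u v e _.
have: x ^+ (u * a) = 1 by rewrite mulnC exprM xa expr1n.
by rewrite e exprD mulnC exprM xb expr1n mul1r.
Qed.

(** The quotient of two roots is killed by the exponents [m] and [#|K|.-1], hence by their gcd. *)
Lemma card_root_le (K : finFieldType) (m : nat) (c : K) : (0 < m)%N -> c != 0 ->
  (#|[set y : K | y ^+ m == c]| <= gcdn m #|K|.-1)%N.
Proof.
move=> m0 c0; have [->|[y0]] := set_0Vmem [set y : K | y ^+ m == c].
  by rewrite cards0.
rewrite inE => /eqP yc.
have root_neq0 y : y ^+ m = c -> y != 0.
  by move=> ym; apply: contra_eq_neq ym => ->; rewrite expr0n gtn_eqF // eq_sym.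
have y1 : y0 \is a GRing.unit by rewrite unitfE root_neq0.
rewrite -[leqRHS](@card_unity_roots K) ?dvdn_gcdr //.
rewrite -[leqRHS](card_imset _ (mulIr y1)); apply: subset_leq_card.
apply/subsetP => y; rewrite inE => /eqP ym; apply/imsetP.
exists (y / y0); last by rewrite divrK.
rewrite inE; apply/eqP/expr_gcd_eq1.
  by rewrite expr_div_n ym yc divff.
by apply/eqP; rewrite expf_card_pred mulf_neq0 ?invr_eq0 // root_neq0.
Qed.

(** Write [c] as a power [z ^+ i] of a generator. The hypothesis forces [m] to divide [i], so one
    root exists, and the others are its multiples by the [m]-th roots of unity. *)
Lemma card_root_eq (K : finFieldType) (m : nat) (c : K) :
  (m %| #|K|.-1)%N -> c ^+ (#|K|.-1 %/ m) = 1 ->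
  #|[set y : K | y ^+ m == c]| = m.
Proof.
move=> mK cl; have [z zP] := finField_prim_root K.
have K0 := prim_order_gt0 zP.
have m0 : (0 < m)%N by apply: dvdn_gt0 mK.
have l0 : (0 < #|K|.-1 %/ m)%N by rewrite divn_gt0 // dvdn_leq.
have c0 : c != 0.
  by apply: contra_eq_neq cl => ->; rewrite expr0n gtn_eqF // eq_sym oner_eq0.
have [i ci] : {i : 'I_#|K|.-1 | c = z ^+ i}.
  by apply: (prim_rootP zP); apply/eqP; rewrite expf_card_pred.
have /dvdnP[j ij] : (m %| i)%N.
  move: cl; rewrite ci -exprM => /eqP; rewrite -(prim_order_dvd zP).
  by rewrite -{1}(divnK mK) mulnC dvdn_pmul2r.
have y1 : z ^+ j \is a GRing.unit.
  by rewrite unitrX // unitfE -expf_card_pred (prim_expr_order zP).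
rewrite -[RHS](card_unity_roots mK) -[RHS](card_imset _ (mulIr y1)).
apply: eq_card => y; rewrite inE; apply/eqP/imsetP => [ym|[x]].
  exists (y / z ^+ j); rewrite ?divrK // inE expr_div_n ym ci ij -exprM divff //.
  by rewrite expf_neq0 // -expf_card_pred (prim_expr_order zP).
by rewrite inE => /eqP xm ->; rewrite exprMn xm mul1r ci ij exprM.
Qed.

(** The pair stands for the ratios [u = (1 + s) / (1 + t)] and [w = s / t] of two points of the
    line. The three inequalities make [s] and [t] distinct and recoverable from [(u, w)], and the
    last condition says that the monomials of [s] and [t] have the same [l]-th power. *)
Definition unity_pairs (K : finFieldType) (k r l : nat) : {set K * K} :=
  [set x : K * K | [&& x.1 ^+ k == 1, x.2 ^+ k == 1, x.1 != 1, x.2 != 1,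
                       x.1 != x.2 & (x.1 * x.2 ^+ r) ^+ l == 1]].

(** Inclusion-exclusion. Without the inequalities there are [d * l * l] pairs. By coprimality each
    of the loci [u = 1], [w = 1], [u = w] contains [l] of them, and any two of these loci meet only
    in [(1, 1)]. *)
Lemma card_unity_pairs (K : finFieldType) (d l r : nat) :
  (d * l %| #|K|.-1)%N -> coprime d r -> coprime d r.+1 ->
  (#|unity_pairs K (d * l) r l| + 3 * l = d * l * l + 2)%N.
Proof.
move=> kK cdr cdr1.
have K0 := card_finField_pred_gt0 K.
have k0 : (0 < d * l)%N by apply: dvdn_gt0 kK.
have l0 : (0 < l)%N by move: k0; rewrite muln_gt0 => /andP[].
have lK : (l %| #|K|.-1)%N by apply: dvdn_trans kK; apply: dvdn_mull.
have nz (x : K) j : (0 < j)%N -> x ^+ j == 1 -> x != 0.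
  by move=> j0; apply: contraTneq => ->; rewrite expr0n gtn_eqF // eq_sym oner_eq0.
have unl j : coprime d j ->
    forall x : K, (x ^+ (d * l) == 1) && (x ^+ (j * l) == 1) = (x ^+ l == 1).
  move=> cdj x; apply/andP/eqP => [[/eqP xk /eqP xj]|xl]; last first.
    by rewrite ![(_ * l)%N]mulnC !exprM xl !expr1n.
  by have := expr_gcd_eq1 xk xj; rewrite -muln_gcdl (eqP cdj) mul1n.
pose A := [set x : K * K | [&& x.1 ^+ (d * l) == 1, x.2 ^+ (d * l) == 1
                            & (x.1 * x.2 ^+ r) ^+ l == 1]].
have cA : #|A| = (d * l * l)%N.
  rewrite -{1}(card_unity_roots kK) -[X in (_ * X)%N](card_unity_roots lK).
  rewrite mulnC -cardsX.
  (* A pair [(u, w)] amounts to a free choice of [w] and of the [l]-th root of unity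
     [u * w ^+ r]. *)
  rewrite -[RHS](@card_in_imset _ _ (fun x => (x.1 / x.2 ^+ r, x.2))).
    apply: eq_card => -[u w]; rewrite !inE /=; apply/and3P/imsetP => /=.
      case=> uk wk uwl; exists (u * w ^+ r, w); first by rewrite !inE uwl wk.
      by rewrite /= mulfK // expf_neq0 // (nz _ _ k0 wk).
    case=> -[c w']; rewrite !inE /= => /andP[/eqP cl wk] [-> ->].
    rewrite wk divfK ?cl ?expf_neq0 ?(nz _ _ k0 wk) //.
    by rewrite expr_div_n exprAC (eqP wk) expr1n mulnC exprM cl expr1n divr1.
  move=> [c w] [c' w']; rewrite !inE /= => /andP[_ wk] /andP[_ _] [+ e].
  by rewrite -e => /divIf -> //; rewrite expf_neq0 // (nz _ _ k0 wk).
have c1 : #|[set x in A | x.1 == 1]| = l.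
  rewrite -[RHS](card_unity_roots lK).
  have inj : injective (fun w : K => (1 : K, w)) by move=> x y [].
  rewrite -[RHS](card_imset _ inj).
  apply: eq_card => -[u w]; rewrite !inE /=; apply/andP/imsetP => /=.
    case=> /and3P[_ wk uwl] /eqP u1; exists w; last by rewrite u1.
    by rewrite inE -(unl _ cdr) wk exprM -[w ^+ r]mul1r -{1}u1.
  case=> w'; rewrite inE -(unl _ cdr) => /andP[wk wr] [-> ->].
  by rewrite eqxx wk mul1r -exprM expr1n eqxx.
have c2 : #|[set x in A | x.2 == 1]| = l.
  rewrite -[RHS](card_unity_roots lK).
  have inj : injective (fun w : K => (w, 1 : K)) by move=> x y [].
  rewrite -[RHS](card_imset _ inj).
  apply: eq_card => -[u w]; rewrite !inE /=; apply/andP/imsetP => /=.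
    case=> /and3P[uk _ uwl] /eqP w1; exists u; last by rewrite w1.
    by move: uwl; rewrite inE w1 expr1n mulr1.
  case=> u'; rewrite inE => /eqP ul [-> ->].
  by rewrite !expr1n mulr1 mulnC exprM ul expr1n eqxx.
have c3 : #|[set x in A | x.1 == x.2]| = l.
  rewrite -[RHS](card_unity_roots lK).
  have inj : injective (fun w : K => (w, w)) by move=> x y [].
  rewrite -[RHS](card_imset _ inj).
  apply: eq_card => -[u w]; rewrite !inE /=; apply/andP/imsetP => /=.
    case=> /and3P[uk wk uwl] /eqP uw; exists u; last by rewrite uw.
    by rewrite inE -(unl _ cdr1) uk exprM exprS {2}uw.
  case=> w'; rewrite inE -(unl _ cdr1) => /andP[wk wr] [-> ->].
  by rewrite eqxx wk -exprS -exprM wr.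
have c12 : #|[set x in A | (x.1 == 1) && (x.2 == 1)]| = 1%N.
  rewrite (_ : [set x in A | _] = [set (1, 1)]) ?cards1 //.
  apply/setP => -[u w]; rewrite !inE /= xpair_eqE.
  by apply/andP/andP => [[_ /andP[-> ->]]|[/eqP-> /eqP->]] //;
    rewrite !expr1n mulr1 expr1n eqxx.
set G := unity_pairs _ _ _ _.
pose e1 (x : K * K) := x.1 == 1; pose e2 (x : K * K) := x.2 == 1.
(* At each point of [A] zero, one or all three of the equalities hold; in the last case the point is
   counted three times, which the term with factor 2 offsets. *)
have : (#|G| + (#|[set x in A | e1 x]| + #|[set x in A | e2 x]|
         + #|[set x in A | x.1 == x.2]|)
       = #|A| + 2 * #|[set x in A | e1 x && e2 x]|)%N.
  have GA : G = [set x in A | [&& x.1 != 1, x.2 != 1 & x.1 != x.2]].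
    by apply/setP => x; rewrite !inE; do !case: (_ == _).
  rewrite GA; have cardE (P : pred (K * K)) :
      #|[set x in A | P x]| = (\sum_(x in A) P x)%N.
    by rewrite -sum1dep_card big_mkcondr.
  rewrite !cardE -sum1_card /e1 /e2 big_distrr -!big_split /=; apply: eq_bigr => -[u w] _ /=.
  case: (u =P 1) => [->|u1]; case: (w =P 1) => [->|w1]; rewrite ?eqxx //=.
  - by rewrite (introF eqP (nesym w1)).
  - by rewrite (introF eqP u1).
  - by case: eqP.
by rewrite c1 c2 c3 c12 cA; lia.
Qed.

End RootsOfUnity.

(** * The Kummer cover of the punctured line, and its collisions *)

Section Torus.
Import GRing.Theory.
Local Open Scope ring_scope.
Variables (K : finFieldType) (r : nat).

Definition punctured_line : {set K} := [set b | (b != 0) && (1 + b != 0)].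

Definition line_monomial (b : K) : K := (1 + b) * b ^+ r.

Definition line_fibre (l : nat) : {set K} :=
  [set b in punctured_line | line_monomial b ^+ l == 1].

Definition kummer_points (m : nat) : {set K * K} :=
  [set x : K * K | (x.1 \in punctured_line) && (x.2 ^+ m == line_monomial x.1)].

Lemma line_monomial_neq0 b : b \in punctured_line -> line_monomial b != 0.
Proof. by rewrite inE => /andP[b0 b1]; rewrite mulf_neq0 // expf_neq0. Qed.

Lemma card_punctured_line : (#|punctured_line| + 2 = #|K|)%N.
Proof.
rewrite -(cardsC punctured_line) (_ : ~: _ = [set 0; -1]) ?cards2.
  by rewrite eq_sym oppr_eq0 oner_eq0.
by apply/setP => b; rewrite !inE negb_and !negbK addrC addr_eq0.
Qed.

Lemma card_kummer_points m :
  #|kummer_points m|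
    = (\sum_(b in punctured_line) #|[set y : K | y ^+ m == line_monomial b]|)%N.
Proof.
rewrite -sum1_card.
rewrite (eq_bigl (fun x : K * K => (x.1 \in punctured_line)
            && (x.2 ^+ m == line_monomial x.1))); last by move=> x; rewrite inE.
rewrite -(pair_big_dep (mem punctured_line)
   (fun b y => y ^+ m == line_monomial b) (fun _ _ => 1%N)) /=.
by apply: eq_bigr => b _; rewrite sum1dep_card.
Qed.

Lemma card_line_fibre l :
  #|line_fibre l| = (\sum_(b in punctured_line) (line_monomial b ^+ l == 1%R))%N.
Proof. by rewrite -sum1dep_card big_mkcondr. Qed.

(** A fibre of the cover has at most [gcdn m #|K|.-1] points, and it is empty unless the monomial is
    a power residue, since an [m]-th power is also a gcd-th power. *)
Lemma kummer_points_le m : (0 < m)%N ->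
  (#|kummer_points m| <= gcdn m #|K|.-1
     * #|line_fibre (#|K|.-1 %/ gcdn m #|K|.-1)|)%N.
Proof.
move=> m0; rewrite card_kummer_points card_line_fibre big_distrr.
apply: leq_sum => b /line_monomial_neq0 fb.
case: eqP => [_|fl]; first by rewrite /= muln1 card_root_le.
rewrite /= muln0 leqn0 cards_eq0; apply/eqP/setP => y; rewrite !inE.
apply/negbTE/eqP => ym; apply: fl; rewrite -ym -exprM.
have y0 : y != 0.
  by move: fb; rewrite -ym; apply: contraNneq => ->; rewrite expr0n gtn_eqF.
rewrite muln_divCA_gcd exprM.
by rewrite (eqP (etrans (expf_card_pred y) y0)) expr1n.
Qed.

Lemma kummer_points_eq m : (m %| #|K|.-1)%N ->
  (#|kummer_points m| = m * #|line_fibre (#|K|.-1 %/ m)|)%N.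
Proof.
move=> mK; have m0 : (0 < m)%N by apply: dvdn_gt0 mK; apply: card_finField_pred_gt0.
apply/eqP; rewrite eqn_leq; apply/andP; split.
  by have := kummer_points_le m0; rewrite (gcdn_idPl mK).
rewrite card_kummer_points card_line_fibre big_distrr.
apply: leq_sum => b _; case: eqP => [fl|_]; last by rewrite /= muln0.
by rewrite /= muln1 card_root_eq.
Qed.

(* The collisions off the diagonal are parametrised by the two ratios
   [(1 + s) / (1 + t)] and [s / t], which determine [t]. *)
Lemma card_line_collisions l :
  #|[set x in setX punctured_line punctured_line |
      line_monomial x.1 ^+ l == line_monomial x.2 ^+ l]|
    = (#|punctured_line| + #|unity_pairs K #|K|.-1 r l|)%N.
Proof.
set E := [set x in _ | _].
pose I := [set x in E | x.1 == x.2].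
rewrite -(cardsID I E); congr (_ + _)%N.
  have inj : injective (fun b : K => (b, b)) by move=> x y [].
  rewrite -(card_imset _ inj); apply: eq_card => -[s t].
  apply/idP/imsetP => [|[b bD [-> ->]]].
    rewrite !inE /= => /andP[_ /andP[/andP[/andP[sD _] _] /eqP st]].
    by exists s; rewrite ?inE // st.
  by move: bD; rewrite !inE /= => ->; rewrite !eqxx.
pose h (x : K * K) := ((1 + x.1) / (1 + x.2), x.1 / x.2).
have hE s t : (s, t) \in E :\: I = [&& s != 0, 1 + s != 0, t != 0, 1 + t != 0,
   s != t & line_monomial s ^+ l == line_monomial t ^+ l].
  rewrite !inE /=; case: (s == 0); rewrite ?andbF //=.
  case: (1 + s == 0); rewrite ?andbF //=; case: (t == 0); rewrite ?andbF //=.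
  case: (1 + t == 0); rewrite ?andbF //=.
  by case: (s == t); case: (_ ^+ l == _).
(* Eliminating [s] between [1 + s = u * (1 + t)] and [s = w * t] leaves a linear equation for
   [t]. *)
have inv (s t u w : K) : t != 0 -> 1 + t != 0 -> s != t -> (1 + s) / (1 + t) = u -> s / t = w ->
    [/\ u != w, u != 1, w != 1 & t = (u - 1) / (w - u)].
  move=> t0 t1 st eu ew.
  have es : s = w * t by rewrite -ew (divfK t0).
  have eu' : 1 + s = u * (1 + t) by rewrite -eu (divfK t1).
  have u1 : u != 1.
    by apply: contraNneq st => u1; move/eqP: eu'; rewrite u1 mul1r (inj_eq (addrI _)).
  have w1 : w != 1 by apply: contraNneq st => w1; rewrite es w1 mul1r.
  have key : t * (w - u) = u - 1.
    have -> : t * (w - u) = 1 + w * t - u * (1 + t) + (u - 1) by ring.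
    by rewrite -es eu' subrr add0r.
  have uw : u != w.
    apply: contraNneq u1 => uw; move/eqP: key.
    by rewrite uw subrr mulr0 eq_sym subr_eq0.
  by split=> //; rewrite -key mulfK // subr_eq0 eq_sym.
have hinj : {in E :\: I &, injective h}.
  move=> [s t] [s' t']; rewrite !hE.
  case/and5P=> _ _ t0 t1 /andP[st _] /and5P[_ _ t0' t1' /andP[st' _]] [e1 e2].
  have [_ _ _ et] := inv s t _ _ t0 t1 st erefl erefl.
  have [_ _ _ et'] := inv s' t' _ _ t0' t1' st' erefl erefl.
  have ett : t = t' by rewrite et et' e1 e2.
  by move: e2; rewrite ett => /divIf -> .
rewrite -(card_in_imset hinj); apply: eq_card => -[u w]; apply/imsetP/idP.
  case=> -[s t]; rewrite hE => /and5P[s0 s1 t0 t1 /andP[st fl]] [eu ew].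
  have [uw u1 w1 _] := inv s t u w t0 t1 st (esym eu) (esym ew).
  rewrite inE /= !expf_card_pred u1 w1 uw eu ew !mulf_neq0 ?invr_eq0 //=.
  have ft : line_monomial t ^+ l != 0.
    by rewrite expf_neq0 // line_monomial_neq0 // inE t0.
  by rewrite expr_div_n mulf_div -/(line_monomial s) -/(line_monomial t) expr_div_n (eqP fl) divff.
rewrite inE /= !expf_card_pred => /and5P[u0 w0 u1 w1 /andP[uw /eqP fl]].
have wu0 : w - u != 0 by rewrite subr_eq0 eq_sym uw.
pose t := (u - 1) / (w - u).
have t0 : t != 0 by rewrite mulf_neq0 ?invr_eq0 // subr_eq0.
have t1E : 1 + t = (w - 1) / (w - u) by rewrite /t; field.
have t1 : 1 + t != 0 by rewrite t1E mulf_neq0 ?invr_eq0 // subr_eq0.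
have s1E : 1 + w * t = u * (1 + t) by rewrite /t; field.
exists (w * t, t); last by rewrite /h /= s1E !mulfK.
have st : w * t != t by rewrite -subr_eq0 -{2}[t]mul1r -mulrBl mulf_neq0 // subr_eq0.
rewrite hE st t0 t1 (mulf_neq0 w0 t0) /line_monomial s1E (mulf_neq0 u0 t1) /=.
by rewrite [(w * t) ^+ r]exprMn mulrACA exprMn fl mul1r.
Qed.

End Torus.

(** * Size of the fibre: the general bound and the Hermitian case *)

Section LineFibre.
Import GRing.Theory.
Local Open Scope ring_scope.
Variables (K : finFieldType) (r : nat).

(* Multiplied by [d], the Cauchy-Schwarz bound on collisions reads
   [(d * N - (q ^ 2 - 2)) ^ 2 <= ((d - 1) * q) ^ 2], with [N] the size of the
   fibre. *)
Lemma line_fibre_bound (q d x : nat) :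
  #|K| = (q ^ 2)%N -> (d %| #|K|.-1)%N -> coprime d r -> coprime d r.+1 ->
  (q ^ 2 + q * x <= d * #|line_fibre K r (#|K|.-1 %/ d)| + 2)%N -> (x < d)%N.
Proof.
move=> cK dK cr cr1 hx; set l := (_ %/ d)%N in hx.
have dl : (d * l = #|K|.-1)%N by rewrite mulnC divnK.
have K1 := card_finField_pred_gt0 K; have d0 : (0 < d)%N by apply: dvdn_gt0 dK.
have q0 : (0 < q)%N by move: K1; rewrite cK; case: (q).
have cD := card_punctured_line K.
have cE := card_line_collisions K r l.
have kd : (d * l %| #|K|.-1)%N by rewrite dl.
have := card_unity_pairs kd cr cr1; rewrite dl => cG.
(* Raising to the power [l] identifies classes modulo [d]-th powers with [d]-th roots of unity;
   [line_fibre] is the fibre over 1. *)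
pose S := [set c : K | c ^+ d == 1].
have cS : #|S| = d by apply: card_unity_roots.
have gS : {in punctured_line K, forall b, line_monomial r b ^+ l \in S}.
  move=> b /(line_monomial_neq0 r) fb; rewrite inE -exprM mulnC dl.
  by rewrite expf_card_pred.
have oS : 1 \in S by rewrite inE expr1n.
have := sqr_collisions gS oS.
rewrite cE cS -/(line_fibre K r l).
have NA : (#|line_fibre K r l| <= #|punctured_line K|)%N.
  by apply: subset_leq_card; apply/subsetP => b; rewrite inE => /andP[].
have cQ : (q ^ 2 = d * l + 1)%N by rewrite dl addn1 prednK // ltnW // finNzRing_gt1.
move: NA hx cD cG; rewrite -dl cK.
move: #|punctured_line K| #|line_fibre K r l| => A N.
move: #|unity_pairs _ _ _ _| => G NA hx cD cG H.
rewrite ltnNge; apply/negP => dx; clearbody l.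
clear -d0 q0 cQ NA hx cD cG H dx.
(* Assuming [d <= x], it suffices to contradict the inequality with [x] replaced by [d]. *)
have {}hx : (q ^ 2 + q * d <= d * N + 2)%N.
  by apply: leq_trans hx; rewrite leq_add2l leq_mul2l dx orbT.
have [B eA] : exists B, (A = N + B)%N by exists (A - N)%N; rewrite subnKC.
have [D eD] : exists D, (d = D.+1)%N by exists d.-1; rewrite prednK.
subst A d; move: H; rewrite addKn /= => H.
(* Here [A = q ^ 2 - 2] and [D = d - 1], so [X] is the deviation [d * N - (q ^ 2 - 2)], nonnegative
   by [hx]. *)
have [X eN] : exists X, (D * N = B + X)%N.
  by exists (D * N - B)%N; rewrite subnKC //; lia.
have leX : (q * D.+1 <= X)%N by lia.
have E1 : (D.+1 * (B ^ 2 + D * N ^ 2) = X ^ 2 + D * (N + B) ^ 2)%N.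
  transitivity (B ^ 2 + (D * N) ^ 2 + D * (N ^ 2 + B ^ 2))%N; first by ring.
  transitivity (X ^ 2 + 2 * B * (D * N) + D * (N ^ 2 + B ^ 2))%N; last by ring.
  by rewrite eN; ring.
(* The exact number of collisions, times [d]. The terms in [(N + B) ^ 2] of [E1] and [E2] will
   cancel, leaving [X <= q * D], against [q * D.+1 <= X]. *)
have E2 : (D.+1 * (N + B + G) = (N + B) ^ 2 + D * q ^ 2)%N.
  have eG : (D.+1 * G + 3 * (D.+1 * l) = (D.+1 * l) ^ 2 + 2 * D.+1)%N.
    transitivity (D.+1 * (G + 3 * l))%N; first by ring.
    by rewrite cG; ring.
  have eP : (D.+1 * l = N + B + 1)%N by lia.
  move: eG; rewrite -cD eP; move: (N + B)%N => a.
  by rewrite [(D.+1 * (a + G))%N]mulnDr -!mulnn; move: (D.+1 * G)%N => M; lia.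
have H' : (D.+1 * (B ^ 2 + D * N ^ 2) <= D * (D.+1 * (N + B + G)))%N.
  by rewrite mulnCA leq_mul2l.
move: H'; rewrite E1 E2 => H'.
have {H'} : (X ^ 2 <= (q * D) ^ 2)%N.
  by move: H'; rewrite mulnDr addnC leq_add2l mulnA mulnn mulnC -expnMn.
rewrite leq_sqr => /(leq_trans leX).
by rewrite leq_mul2l ltnn orbF eqn0Ngt q0.
Qed.

(* The F_q-rational points of the line all lie in the fibre; any other point t
   of the line is determined by the norm-one elements (1 + t)^(q-1), t^(q-1). *)
Lemma hermitian_line_fibre (q m : nat) :
  [pchar K].-nat q -> (1 < q)%N -> #|K| = (q ^ 2)%N -> (m %| q.+1)%N ->
  (#|line_fibre K r (#|K|.-1 %/ m)| + 2
     = q + #|unity_pairs K q.+1 r (q.+1 %/ m)|)%N.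
Proof.
move=> qp q1 cK mq; set l := (q.+1 %/ m)%N.
have Kq : (#|K|.-1 = q.-1 * q.+1)%N by rewrite cK; case: q q1 {qp cK mq l} => // q _; nia.
have -> : (#|K|.-1 %/ m = q.-1 * l)%N by rewrite Kq muln_divA.
set N0 := line_fibre _ _ _.
pose fix_ := [set t : K | t ^+ q == t].
have frobD (x y : K) : (x + y) ^+ q = x ^+ q + y ^+ q by apply: exprDn_pchar.
have expq (x : K) : x ^+ q = x ^+ q.-1 * x by rewrite -exprSr prednK // ltnW.
have fix_neq0 (t : K) : t != 0 -> (t ^+ q == t) = (t ^+ q.-1 == 1).
  by move=> t0; rewrite expq -[RHS](inj_eq (mulIf t0)) /= mul1r.
(* Deduced from additivity of Frobenius, so that characteristic 2 needs no separate case. *)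
have fN1 : (-1) ^+ q = -1 :> K.
  have := frobD 1 (-1); rewrite subrr expr1n expr0n gtn_eqF ?(ltnW q1) //=.
  by move/esym/eqP; rewrite addrC addr_eq0 => /eqP.
have c_fix : #|fix_| = q.
  rewrite (cardsD1 0) inE expr0n gtn_eqF ?(ltnW q1) // eqxx.
  have -> : fix_ :\ 0 = [set t : K | t ^+ q.-1 == 1].
    apply/setP => t; rewrite !inE; case: eqVneq => [->|/fix_neq0->//].
    have q10 : (0 < q.-1)%N by case: (q) q1 => [|[]].
    by rewrite [0 ^+ q.-1]expr0n gtn_eqF // [RHS]eq_sym oner_eq0.
  by rewrite card_unity_roots ?Kq ?dvdn_mulr //= add1n prednK // ltnW.
(* For [t] in the subfield other than 0 and -1, both [t] and [1 + t] have [(q-1)]-th power 1, so [t]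
   is in the fibre. *)
have c_fixN : (#|N0 :&: fix_| + 2)%N = q.
  rewrite -[RHS]c_fix -(cardsID [set 0; -1] fix_) addnC; congr (_ + _)%N.
    rewrite (setIidPr _) ?cards2 1?eq_sym ?oppr_eq0 ?oner_eq0 //.
    apply/subsetP => t; rewrite !inE => /orP[]/eqP->; rewrite ?fN1 //.
    by rewrite expr0n gtn_eqF ?(ltnW q1).
  apply: eq_card => t; rewrite !inE negb_or -addr_eq0 [t + 1]addrC.
  case: eqVneq; rewrite ?andbF //= => t0; case: eqVneq; rewrite ?andbF //= => t1.
  case tq: (t ^+ q == t); rewrite ?andbF //= andbT; apply/eqP.
  rewrite /line_monomial exprM exprMn -exprM mulnC exprM.
  have -> : t ^+ q.-1 = 1 by apply/eqP; rewrite -fix_neq0.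
  have -> : (1 + t) ^+ q.-1 = 1.
    by apply/eqP; rewrite -fix_neq0 // frobD expr1n (eqP tq).
  by rewrite !expr1n mulr1 expr1n.
rewrite -(cardsID fix_ N0) addnAC c_fixN; congr (_ + _)%N.
pose h (t : K) := ((1 + t) ^+ q.-1, t ^+ q.-1).
have hE t : t \in N0 :\: fix_ =
    [&& t != 0, 1 + t != 0, t ^+ q != t & line_monomial r t ^+ (q.-1 * l) == 1].
  by rewrite !inE; case: (_ == t); case: (_ == 0); case: (_ == 0).
(* The same linear system as for collisions, with [s = t ^+ q]: Frobenius gives
   [1 + t ^+ q = (1 + t) ^+ q]. *)
have inv (t u w : K) : t != 0 -> 1 + t != 0 -> t ^+ q != t ->
    (1 + t) ^+ q.-1 = u -> t ^+ q.-1 = w ->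
    [/\ u != w, u != 1, w != 1 & t = (u - 1) / (w - u)].
  move=> t0 t1 tq eu ew.
  have et : t ^+ q = w * t by rewrite expq ew.
  have et1 : 1 + w * t = u * (1 + t) by rewrite -et -eu -expq frobD expr1n.
  have w1 : w != 1 by apply: contraNneq tq => w1; rewrite et w1 mul1r.
  have u1 : u != 1.
    apply: contraNneq tq => u1; move/eqP: et1.
    by rewrite u1 mul1r (inj_eq (addrI _)) -et.
  have key : t * (w - u) = u - 1.
    have -> : t * (w - u) = 1 + w * t - u * (1 + t) + (u - 1) by ring.
    by rewrite et1 subrr add0r.
  have uw : u != w.
    apply: contraNneq u1 => uw; move/eqP: key.
    by rewrite uw subrr mulr0 eq_sym subr_eq0.
  by split=> //; rewrite -key mulfK // subr_eq0 eq_sym.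
have hinj : {in N0 :\: fix_ &, injective h}.
  move=> t t'; rewrite !hE.
  case/and4P=> t0 t1 tq _ /and4P[t0' t1' tq' _] [e1 e2].
  have [_ _ _ ->] := inv t _ _ t0 t1 tq erefl erefl.
  by have [_ _ _ ->] := inv t' _ _ t0' t1' tq' erefl erefl; rewrite e1 e2.
have unit1 (x : K) : x != 0 -> (x ^+ q.-1) ^+ q.+1 = 1.
  by move=> x0; apply/eqP; rewrite -exprM -Kq expf_card_pred.
rewrite -(card_in_imset hinj); apply: eq_card => -[u w]; apply/imsetP/idP.
  case=> t; rewrite hE => /and4P[t0 t1 tq fl] [eu ew].
  have [uw u1 w1 _] := inv t u w t0 t1 tq (esym eu) (esym ew).
  rewrite inE /= u1 w1 uw eu ew !unit1 // !eqxx /=.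
  by rewrite exprAC -exprMn -exprM.
rewrite inE /= => /and5P[/eqP uq /eqP wq u1 w1 /andP[uw /eqP fl]].
have nz (x : K) : x ^+ q.+1 = 1 -> x != 0.
  by move=> xq; apply: contra_eq_neq xq => ->; rewrite exprS mul0r eq_sym oner_eq0.
have [u0 w0] := (nz _ uq, nz _ wq).
have wu0 : w - u != 0 by rewrite subr_eq0 eq_sym uw.
pose t := (u - 1) / (w - u).
have t0 : t != 0 by rewrite mulf_neq0 ?invr_eq0 // subr_eq0.
have t1E : 1 + t = (w - 1) / (w - u) by rewrite /t; field.
have t1 : 1 + t != 0 by rewrite t1E mulf_neq0 ?invr_eq0 // subr_eq0.
have s1E : 1 + w * t = u * (1 + t) by rewrite /t; field.
have frobB (x y : K) : (x - y) ^+ q = x ^+ q - y ^+ q.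
  by rewrite frobD -mulN1r exprMn fN1 mulN1r.
(* Frobenius inverts norm-one elements, whence [t ^+ q = w * t] by direct computation. *)
have uq' : u ^+ q = u^-1 by apply: (mulfI u0); rewrite -exprS uq divff.
have wq' : w ^+ q = w^-1 by apply: (mulfI w0); rewrite -exprS wq divff.
have tq : t ^+ q = w * t.
  rewrite /t expr_div_n !frobB expr1n uq' wq'; field.
  by rewrite wu0 u0 w0 mulN1r subr_eq0 uw.
have tw : t ^+ q.-1 = w by apply: (mulIf t0); rewrite -expq tq.
have tu : (1 + t) ^+ q.-1 = u by apply: (mulIf t1); rewrite -expq frobD expr1n tq.
exists t; last by rewrite /h tw tu.
rewrite hE t0 t1 tq -subr_eq0 -{2}[t]mul1r -mulrBl mulf_neq0 ?subr_eq0 //=.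
by rewrite exprM exprMn tu exprAC tw fl.
Qed.

End LineFibre.

(** * Rational points of the plane curve *)

Section Plane.
Import GRing.Theory.
Local Open Scope ring_scope.

Lemma ord3P (i : 'I_3) : [\/ i = 0, i = 1 | i = 2].
Proof.
by case: i => -[|[|[|//]]] i3; [constructor 1|constructor 2|constructor 3];
  apply/val_inj.
Qed.

Definition vec3 (R : nzRingType) (x y z : R) : 'rV[R]_3 :=
  \row_(i < 3) [:: x; y; z]`_i.

Lemma vec3E (R : nzRingType) (x y z : R) :
  ((vec3 x y z 0 0 = x) * (vec3 x y z 0 1 = y) * (vec3 x y z 0 2 = z))%type.
Proof. by rewrite !mxE. Qed.

Lemma row3P (R : nzRingType) (v w : 'rV[R]_3) :
  v 0 0 = w 0 0 -> v 0 1 = w 0 1 -> v 0 2 = w 0 2 -> v = w.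
Proof. by move=> *; apply/rowP => i; case: (ord3P i) => ->. Qed.

Lemma meval_hurwitz (L : fieldType) (n : nat) (v : 'rV[L]_3) :
  (hurwitz L n).@[v 0] =
    v 0 0 ^+ n * v 0 1 + v 0 1 ^+ n * v 0 2 + v 0 2 ^+ n * v 0 0.
Proof. by rewrite /hurwitz !mevalD !mevalM !rmorphXn /= !mevalXU. Qed.

Definition pivot (K : fieldType) (v : 'rV[K]_3) : K :=
  if v 0 2 != 0 then v 0 2 else if v 0 1 != 0 then v 0 1 else v 0 0.

Lemma pivotZ (K : fieldType) (a : K) (v : 'rV[K]_3) :
  a != 0 -> pivot (a *: v) = a * pivot v.
Proof.
move=> a0; rewrite /pivot !mxE !mulf_eq0 (negbTE a0) /=.
by case: eqP => //= _; case: eqP.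
Qed.

Lemma pivot_neq0 (K : fieldType) (v : 'rV[K]_3) : v != 0 -> pivot v != 0.
Proof.
move=> nz; rewrite /pivot; case: (eqVneq (v 0 2) 0) => //= v2.
case: (eqVneq (v 0 1) 0) => //= v1.
by apply: contraNneq nz => v0; apply/eqP/row3P; rewrite ?v0 ?v1 ?v2 mxE.
Qed.

(* Each line is represented by its vector of pivot [1]. *)
Lemma card_rational_points (K : finFieldType) (F : {mpoly K[3]}) :
  (forall (a : K) (v : 'rV[K]_3), F.@[v 0] = 0 -> F.@[(a *: v) 0] = 0) ->
  #|rational_points F| = #|[set v : 'rV[K]_3 | (pivot v == 1) && (F.@[v 0] == 0)]|.
Proof.
move=> FZ; set R := [set v | _].
pose line (v : 'rV[K]_3) := [set a *: v | a : K].
have R0 v : v \in R -> v != 0.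
  rewrite inE => /andP[/eqP v1 _]; apply: contra_eq_neq v1 => ->.
  by rewrite /pivot !mxE eqxx /= eq_sym oner_eq0.
have -> : rational_points F = line @: R.
  apply/setP => l; apply/imsetP/imsetP => -[v]; last first.
    move=> vR ->; exists v => //; rewrite inE R0 //.
    by move: vR; rewrite inE => /andP[].
  rewrite inE => /andP[v0 /eqP Fv] ->.
  have p0 := pivot_neq0 v0; exists ((pivot v)^-1 *: v).
    by rewrite inE pivotZ ?invr_eq0 // mulVf // eqxx FZ ?eqxx.
  apply/setP => w; apply/imsetP/imsetP => -[a _ ->].
    by exists (a * pivot v) => //; rewrite scalerA mulfK.
  by exists (a / pivot v) => //; rewrite scalerA.
apply: card_in_imset => v w vR wR e.
have : v \in line w by rewrite -e; apply/imsetP; exists 1; rewrite ?scale1r.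
case/imsetP => a _ va; have v0 := R0 _ vR.
have a0 : a != 0 by apply: contraNneq v0 => a0; rewrite va a0 scale0r.
move: vR wR; rewrite !inE => /andP[/eqP pv _] /andP[/eqP pw _].
by move: pv; rewrite va pivotZ // pw mulr1 => ->; rewrite scale1r.
Qed.

(** A point of the curve with a zero coordinate is one of the three coordinate points. Elsewhere
    take [Z = 1]: the Kummer coordinates are [b = y ^+ n.+1 / x], the ratio of the second monomial
    to the third, and [- y]. *)
Lemma card_hurwitz_points (K : finFieldType) (n : nat) :
  #|rational_points (hurwitz K n.+1)|
    = (3 + #|kummer_points K n (n * n.+1).+1|)%N.
Proof.
rewrite card_rational_points => [|a v]; last first.
  rewrite !meval_hurwitz => Fv; rewrite !mxE !exprMn.
  have E x y : a ^+ n.+1 * x * (a * y) = a ^+ n.+2 * (x * y).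
    by rewrite (exprS _ n.+1); ring.
  by rewrite !E -!mulrDr Fv mulr0.
set R := [set v | _]; pose B := [set vec3 1 0 0; vec3 0 1 0; vec3 0 0 1 : 'rV[K]_3].
pose h (x : K * K) := vec3 ((- x.2) ^+ n.+1 / x.1) (- x.2) 1.
set C := kummer_points _ _ _.
have C0 b y : (b, y) \in C -> b != 0 /\ y != 0.
  rewrite inE /= => /andP[bD /eqP ym]; split; first by move: bD; rewrite inE => /andP[].
  by have := line_monomial_neq0 n bD; rewrite -ym expf_eq0.
have hinj : {in C &, injective h}.
  move=> [b y] [b' y'] /C0[b0 y0] /C0[b0' y0'] e.
  have ey : y = y'.
    by apply: oppr_inj; have := congr1 (fun v : 'rV_3 => v 0 1) e; rewrite !vec3E.
  have := congr1 (fun v : 'rV_3 => v 0 0) e; rewrite !vec3E /= ey.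
  move/(mulfI _) => eb; congr (_, _); apply: invr_inj; apply: eb.
  by rewrite expf_neq0 // oppr_eq0.
(* The equation reads [y ^ m = - (1 + b) * b ^ n]; as [m] is odd, the sign is absorbed in [- y]. *)
have odd_sgn : (-1) ^+ (n * n.+1).+1 = -1 :> K.
  by rewrite -signr_odd /= oddM /= andbN.
have on_curve (x y b : K) : b != 0 -> y != 0 -> x = y ^+ n.+1 / b ->
   (x ^+ n.+1 * y + y ^+ n.+1 + x == 0)
     = ((- y) ^+ (n * n.+1).+1 == line_monomial n b).
  move=> b0 y0 ->; rewrite -[- y]mulN1r [(-1 * y) ^+ _]exprMn odd_sgn /line_monomial mulN1r eqr_oppLR.
  rewrite -addr_eq0.
  have -> : (y ^+ n.+1 / b) ^+ n.+1 * y + y ^+ n.+1 + y ^+ n.+1 / b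
    = (y ^+ n.+1 / b ^+ n.+1) * (y ^+ (n * n.+1).+1 + (1 + b) * b ^+ n).
    have -> : (y ^+ n.+1 / b) ^+ n.+1 = y ^+ n.+1 * y ^+ (n * n.+1) / b ^+ n.+1.
      by rewrite expr_div_n -exprM -exprD -mulSn.
    rewrite (exprSr y (n * _)) (exprS b).
    by field; rewrite b0 expf_neq0.
  by rewrite mulf_eq0 mulf_eq0 invr_eq0 !expf_eq0 /= (negbTE y0) (negbTE b0).
pose simp := (eqxx, oner_eq0 K, mulr0, mul0r, addr0, andbT).
have -> : R = B :|: h @: C.
  apply/setP => v; rewrite !inE; apply/idP/idP; last first.
    case/orP => [/orP[/orP[]|]|/imsetP[[b y] byC ->]].
    - by move/eqP->; rewrite meval_hurwitz /pivot !vec3E !expr0n !simp /= ?simp.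
    - by move/eqP->; rewrite meval_hurwitz /pivot !vec3E !expr0n !simp /= ?simp.
    - by move/eqP->; rewrite meval_hurwitz /pivot !vec3E !expr0n !simp /= ?simp.
    have [b0 y0] := C0 _ _ byC.
    rewrite meval_hurwitz /pivot !vec3E oner_eq0 /= eqxx mulr1 expr1n mul1r.
    rewrite (on_curve _ _ b) ?oppr_eq0 // opprK.
    by move: byC; rewrite inE => /andP[].
  rewrite meval_hurwitz => /andP[/eqP]; rewrite /pivot.
  case: (eqVneq (v 0 2) 0) => /= [v2|v20 v2].
    rewrite v2 mulr0 addr0 expr0n mul0r addr0 mulf_eq0 expf_eq0 /=.
    case: (eqVneq (v 0 1) 0) => /= [v1 v0 _|v10 v1].
      by rewrite (_ : v = vec3 1 0 0) ?eqxx //; apply: row3P; rewrite vec3E.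
    rewrite orbF => /eqP v0.
    by rewrite (_ : v = vec3 0 1 0) ?eqxx ?orbT //; apply: row3P; rewrite vec3E.
  rewrite v2 mulr1 expr1n mul1r.
  case: (eqVneq (v 0 1) 0) => [v1|v1].
    rewrite v1 mulr0 expr0n !add0r => /eqP v0.
    by rewrite (_ : v = vec3 0 0 1) ?eqxx ?orbT //; apply: row3P; rewrite vec3E.
  case: (eqVneq (v 0 0) 0) => [v0|v0].
    by rewrite v0 expr0n mul0r add0r addr0 expf_eq0 (negbTE v1) andbF.
  set y := v 0 1 in v1 *; pose b := y ^+ n.+1 / v 0 0.
  have b0 : b != 0 by rewrite mulf_neq0 ?invr_eq0 ?expf_neq0.
  have ex : v 0 0 = y ^+ n.+1 / b by rewrite /b invf_div mulrCA divff ?mulr1 ?expf_neq0.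
  rewrite (on_curve _ _ b) // => /eqP ym.
  apply/orP; right; apply/imsetP; exists (b, - y); last first.
    by apply: row3P; rewrite vec3E //= opprK.
  rewrite inE /= ym eqxx andbT inE b0 /=.
  have : (- y) ^+ (n * n.+1).+1 != 0 by rewrite expf_neq0 // oppr_eq0.
  by rewrite ym mulf_eq0 => /norP[].
have -> : #|B :|: h @: C| = (#|B| + #|h @: C|)%N.
  rewrite -cardsUI (_ : B :&: _ = set0) ?cards0 ?addn0 //.
  apply/setP => v; rewrite !inE; apply/negP => /andP[+ /imsetP[[b y] /C0[b0 y0] ev]].
  rewrite ev => /orP[/orP[]|] /eqP/(congr1 (fun v : 'rV_3 => (v 0 1, v 0 2))).
  - by rewrite !vec3E /= => -[_ /eqP]; rewrite oner_eq0.
  - by rewrite !vec3E /= => -[_ /eqP]; rewrite oner_eq0.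
  - by rewrite !vec3E /= => -[/eqP]; rewrite oppr_eq0 (negbTE y0).
rewrite (card_in_imset hinj); congr (_ + _)%N.
have neq (v w : 'rV[K]_3) (i : 'I_3) : v 0 i != w 0 i -> v != w.
  by apply: contraNneq => ->.
rewrite /B -setUA cardsU1 cards2 !inE negb_or.
by rewrite (neq _ (vec3 0 1 0) 1) ?(neq _ (vec3 0 0 1) 2) //;
  rewrite !vec3E eq_sym oner_eq0.
Qed.

End Plane.

(** * Genus *)

Section Hilbert.
Import GRing.Theory Num.Theory.
Local Open Scope ring_scope.

(** Uniqueness of the Hilbert polynomial: a nonzero difference would have too many roots. *)
Lemma eq_poly_nat (R : numFieldType) (N : nat) (P Q : {poly R}) :
  (forall d, (N <= d)%N -> P.[d%:R] = Q.[d%:R]) -> P = Q.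
Proof.
move=> PQ; apply/eqP; rewrite -subr_eq0; apply/negPn/negP => nz.
pose rs : seq R := [seq i%:R | i <- iota N (size (P - Q))].
have: (size rs < size (P - Q)%R)%N.
  apply: max_poly_roots => //.
    apply/allP => _ /mapP[i + ->]; rewrite mem_iota => /andP[Ni _].
    by rewrite rootE hornerD hornerN PQ // subrr.
  by rewrite map_inj_uniq ?iota_uniq // => i j /eqP; rewrite eqr_nat => /eqP.
by rewrite size_map size_iota ltnn.
Qed.

(** Allows the cofactor of a homogeneous multiple of [F] to be replaced by its homogeneous part of
    the right degree. *)
Lemma pihomogM (R : idomainType) (k e D : nat) (H F : {mpoly R[k]}) :
  F \is D.-homog -> pihomog mdeg (e + D) (H * F) = pihomog mdeg e H * F.
Proof.
move=> hF; pose s := maxn (mmeasure mdeg H) e.+1.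
have sH : (mmeasure mdeg H <= s)%N by rewrite leq_maxl.
have se : (e < s)%N by rewrite leq_maxr.
rewrite {1}(pihomog_partitionE sH) mulr_suml linear_sum /=.
rewrite (bigD1 (Ordinal se)) //= big1 ?addr0 => [|i ie].
  by rewrite pihomog_dE // dhomogM // pihomogP.
apply: (@pihomog_ne0 _ _ _ (i + D)%N); last by rewrite dhomogM // pihomogP.
by rewrite eqn_add2r; apply: contraNneq ie => ie; apply/eqP/val_inj.
Qed.

Variables (K : fieldType) (D : nat) (F : {mpoly K[3]}) (hF : F \is D.-homog).

Definition mul_dhomog (e : nat) (G : dhomog 3 K e) : dhomog 3 K (e + D) :=
  DHomog (dhomogM (dhomog_is_dhomog G) hF).

Lemma mul_dhomog_is_linear e : linear (@mul_dhomog e).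
Proof.
by move=> a G H; apply/val_inj; rewrite /= mulrDl scalerAl.
Qed.

HB.instance Definition _ (e : nat) :=
  GRing.isLinear.Build K (dhomog 3 K e) (dhomog 3 K (e + D)) _
    (@mul_dhomog e) (@mul_dhomog_is_linear e).

Lemma dim_dhomog3 (d : nat) : \dim {: dhomog 3 K d} = 'C(d + 2, 2).
Proof. by rewrite dimvf -[RHS]bin_sub ?leq_addl // addnK. Qed.

Hypothesis F0 : F != 0.

(** Multiplication by [F] is injective on forms of degree [e], and its image is the degree [e + D]
    part of the ideal. *)
Lemma hilbert_valueP (e r : nat) :
  hilbert_value F (e + D) r <-> (r + 'C(e + 2, 2) = 'C(e + D + 2, 2))%N.
Proof.
pose f := linfun (@mul_dhomog e).
have fP (G : dhomog 3 K (e + D)) :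
    G \in limg f <-> exists H : {mpoly K[3]}, mpoly_of_dhomog G = H * F.
  split=> [/memv_imgP[H _ ->]|[H GH]].
    by exists (mpoly_of_dhomog H); rewrite lfunE.
  apply/memv_imgP; exists (DHomog (pihomogP mdeg e H)); first exact: memvf.
  apply/val_inj; rewrite lfunE /= -(pihomogM _ _ hF) -GH pihomog_dE //; exact: dhomog_is_dhomog.
have df : \dim (limg f) = 'C(e + 2, 2).
  rewrite limg_dim_eq ?dim_dhomog3 //; apply/eqP; rewrite -subv0.
  apply/subvP => G; rewrite memv_cap memv_ker => /andP[_ /eqP fG].
  rewrite memv0; apply/eqP/val_inj/(mulIf F0); rewrite mul0r.
  by move/(congr1 (@mpoly_of_dhomog _ _ _)): fG; rewrite lfunE.
split=> [[V VP]|rE]; last by exists (limg f); rewrite // df dim_dhomog3.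
have -> : V = limg f.
  by apply/vspaceP => G; apply/idP/idP => [/VP/fP|/fP/VP].
by rewrite df dim_dhomog3.
Qed.

End Hilbert.

Section Genus.
Import GRing.Theory Num.Theory.
Local Open Scope ring_scope.

(** A difference of binomial coefficients shows that the Hilbert polynomial in degree [D = n.+2] is
    [D * X + 1 - (D - 1) * (D - 2) / 2]. *)
Lemma has_genusP (K : fieldType) (n g : nat) (F : {mpoly K[3]}) :
  F \is n.+2.-homog -> F != 0 -> has_genus F g <-> (2 * g = n.+1 * n)%N.
Proof.
move=> hF F0; pose P (c : rat) : {poly rat} := n.+2%:R *: 'X + (1 - c)%:P.
have PE c x : (P c).[x] = n.+2%:R * x + 1 - c.
  by rewrite /P !hornerE.
have bin2E a : (2 * 'C(a + 2, 2) = (a + 2) * (a + 1))%N.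
  by rewrite mulnC (bin_ffact (a + 2) 2) addn2 addn1 ffactSS ffactn1.
have key e r : (r + 'C(e + 2, 2) = 'C(e + n.+2 + 2, 2))%N ->
    r%:R = (P ((n.+1 * n)%:R / 2)).[(e + n.+2)%:R].
  move=> rE; have r2 : (2 * r + n.+1 * n = 2 * (n.+2 * (e + n.+2)) + 2)%N.
    have := bin2E e; have := bin2E (e + n.+2)%N; rewrite -rE; nia.
  rewrite PE; have /(congr1 (fun k => k%:R : rat)) := r2.
  rewrite natrD [(2 * r)%:R]natrM [in RHS]natrD [(2 * _)%:R]natrM [(n.+2 * _)%:R]natrM => e2.
  apply: (mulfI (_ : 2 != 0 :> rat)) => //.
  by rewrite mulrBr mulrDr mulr1 -e2; field.
split=> [[Q [d0 QP] gE]|gE].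
  have QE : Q = P ((n.+1 * n)%:R / 2).
    apply: (@eq_poly_nat _ (d0 + n.+2)) => d dd.
    have [r hr <-] := QP d (leq_trans (leq_addr _ _) dd).
    have nd : (n.+2 <= d)%N by apply: leq_trans dd; apply: leq_addl.
    move: hr; rewrite -(subnK nd) => /(hilbert_valueP hF F0); exact: key.
  move: gE; rewrite QE PE mulr0 add0r opprB addrC addrNK => gE.
  by apply/eqP; rewrite -(eqr_nat rat) natrM gE mulrC divfK.
exists (P g%:R); last by rewrite PE mulr0 add0r opprB addrC addrNK.
exists n.+2 => d nd; exists ('C(d + 2, 2) - 'C(d - n.+2 + 2, 2))%N.
  rewrite -{1}(subnK nd); apply/(hilbert_valueP hF F0).
  by rewrite (subnK nd) subnK // leq_bin2l // leq_add2r leq_subr.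
rewrite (key (d - n.+2)%N) ?(subnK nd) //; last first.
  by rewrite subnK // leq_bin2l // leq_add2r leq_subr.
by rewrite -gE natrM [2 * _]mulrC mulfK.
Qed.

End Genus.

(** * Irreducibility *)

Section Eisenstein.
Import GRing.Theory.
Local Open Scope ring_scope.

(** Since [p] has a nonzero constant term, the coefficients of [q] below [N] vanish one after the
    other, so [q] takes up the whole degree. *)
Lemma size_mul_monomial (R : idomainType) (p q : {poly R}) (b : R) (N : nat) :
  b != 0 -> p * q = b *: 'X^N -> p`_0 != 0 -> size p = 1%N.
Proof.
move=> b0 pq p0.
have s : size (p * q) = N.+1 by rewrite pq size_scale // size_polyXn.
have nz : p * q != 0 by rewrite -size_poly_gt0 s.
have [pn qn] : p != 0 /\ q != 0 by move: nz; rewrite mulf_eq0 => /norP.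
have qi i : (i < N)%N -> q`_i = 0.
  have [k ik] := ubnP i; elim: k i ik => // k IH i ik iN.
  have : (p * q)`_i = 0 by rewrite pq coefZ coefXn ltn_eqF // mulr0.
  rewrite coefM big_ord_recl /= subn0 big1 => [/eqP|j _].
    by rewrite addr0 mulf_eq0 (negbTE p0) => /eqP.
  by rewrite IH ?mulr0 // /bump leq0n add1n; have := ltn_ord j; lia.
have Nq : (N < size q)%N.
  rewrite ltnNge; apply: contra qn => qN; apply/eqP/polyP => i; rewrite coef0.
  by case: (ltnP i N) => [/qi//|Ni]; rewrite nth_default // (leq_trans qN).
by move: s Nq; rewrite size_mul // (polySpred pn); lia.
Qed.

(* Eisenstein's criterion at the prime [Y] of [B[Y]]. *)
Lemma eisensteinX (B : idomainType) (G H : {poly {poly B}}) (b : B) (N : nat) :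
  b != 0 -> map_poly (horner_eval 0) (G * H) = b *: 'X^N ->
  (size (G * H)%R <= N.+1)%N -> ((G * H)`_0)`_1 != 0 ->
  size G = 1%N \/ size H = 1%N.
Proof.
move=> b0 bGH sGH c1.
have eGH : (map_poly (horner_eval 0) G) * (map_poly (horner_eval 0) H) = b *: 'X^N.
  by rewrite -rmorphM.
set g := map_poly _ G in eGH; set h := map_poly _ H in eGH.
have gh0 : g * h != 0 by rewrite eGH -size_poly_gt0 size_scale // size_polyXn.
have [g0 h0] : g != 0 /\ h != 0 by move: gh0; rewrite mulf_eq0 => /norP.
have sgh : (size g + size h).-1 = N.+1.
  by rewrite -size_mul // eGH size_scale // size_polyXn.
have sg : (size g <= size G)%N by apply: size_poly.
have sh : (size h <= size H)%N by apply: size_poly.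
have nz : G * H != 0 by apply: contraNneq c1 => ->; rewrite !coef0.
have [G0 H0] : G != 0 /\ H != 0 by move: nz; rewrite mulf_eq0 => /norP.
move: sGH; rewrite size_mul // => sGH.
have sg0 : (0 < size g)%N by rewrite size_poly_gt0.
have sh0 : (0 < size h)%N by rewrite size_poly_gt0.
(* The degree of the product does not drop modulo [Y], so neither does that of a factor. *)
have [eG eH] : size G = size g /\ size H = size h.
  move: sGH sgh sg sh sg0 sh0.
  by move: (size G) (size H) (size g) (size h) => *; lia.
(* Otherwise [Y ^ 2] would divide the constant term of [G * H]. *)
have : (g`_0 != 0) || (h`_0 != 0).
  apply: contraR c1; rewrite negb_or !negbK !coef_map /= /horner_eval.
  rewrite !horner_coef0 => /andP[/eqP G00 /eqP H00].
  by rewrite coef0M coefM big_ord_recl big_ord1 /= G00 H00 mul0r mulr0 addr0.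
case/orP => [gz|hz]; [left|right].
  by rewrite eG (size_mul_monomial b0 eGH).
by rewrite eH (@size_mul_monomial _ h g b N) // mulrC.
Qed.

End Eisenstein.

Section Irreducible.
Import GRing.Theory.
Local Open Scope ring_scope.

(** Primitivity over [L[X][Y]]: [g] divides every coefficient in [Z], hence a nonzero element of
    [L[X]], which makes it constant in [Y], and a polynomial monic in [Y], which makes that constant
    a unit. *)
Lemma constant_divisor_unit (L : fieldType) (n : nat) (g : {poly {poly L}})
    (H : {poly {poly {poly L}}}) :
  g%:P * H = ('X%:P)%:P * 'X^(n.+1) + ('X^(n.+1))%:P * 'X + ('X%:P ^+ n.+1 * 'X)%:P ->
  g%:P \is a GRing.unit.
Proof.
move=> e.
have X0 : ('X : {poly L}) != 0 by rewrite polyX_eq0.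
have cE i : g * H`_i = 'X%:P *+ (i == n.+1) + 'X^(n.+1) *+ (i == 1%N)
     + ('X%:P ^+ n.+1 * 'X) *+ (i == 0%N).
  by rewrite -coefCM e !coefD !coefCM coefXn coefX coefC !mulr_natr; case: (i == 0%N).
have [k [c [h [m [gk c0 gh mon]]]]] :
    exists k c h m, [/\ g * k = c%:P, c != 0, g * h = m & m \is monic].
  (* For [n = 0]: [X * (X + Y) - X * Y = X ^ 2]. *)
  case: n cE {e} => [|n] cE.
    exists ('X%:P * H`_1 - H`_0), ('X ^+ 2), H`_1, ('X + 'X%:P); split=> //.
    - rewrite mulrBr mulrCA !cE /= expr1 !mulr0n !mulr1n !add0r !addr0.
      by rewrite mulrDr addrK rmorphXn.
    - by rewrite expf_neq0.
    - by rewrite cE /= expr1 mulr0n mulr1n addr0 addrC.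
    by rewrite monicE lead_coefDl ?lead_coefX // size_polyX size_polyC X0.
  exists H`_n.+2, 'X, H`_1, 'X^(n.+2); rewrite !cE eqxx /= !mulr0n !mulr1n !addr0.
  by rewrite add0r monicXn.
have g1 : size g = 1%N.
  have := congr1 (fun p : {poly {poly L}} => size p) gk; rewrite size_polyC c0.
  have : g * k != 0 by rewrite gk polyC_eq0.
  rewrite mulf_eq0 => /norP[gn kn]; rewrite size_mul //.
  move: gn kn; rewrite -!size_poly_gt0.
  by move: (size g) (size k) => *; lia.
have lg : lead_coef g * lead_coef h = 1 by rewrite -lead_coefM gh; apply/eqP.
have ug : lead_coef g \is a GRing.unit.
  by apply/unitrP; exists (lead_coef h); rewrite mulrC lg.
have gE : g = (lead_coef g)%:P by rewrite lead_coefE g1 [LHS]size1_polyC ?g1.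
by rewrite gE !rmorph_unit.
Qed.

(* [L[X][Y][Z]]: the innermost variable is [X] and the outermost is [Z]. *)
Definition poly3_of_mpoly (L : fieldType) : {mpoly L[3]} -> {poly {poly {poly L}}} :=
  mmap (polyC \o polyC \o polyC) (fun i : 'I_3 => [:: 'X%:P%:P; 'X%:P; 'X]`_i).

Definition mpoly_of_poly3 (L : fieldType) : {poly {poly {poly L}}} -> {mpoly L[3]} :=
  horner_eval 'X_2 \o map_poly (horner_eval 'X_1 \o
    map_poly (horner_eval 'X_0 \o map_poly (@mpolyC 3 L))).
HB.instance Definition _ (L : fieldType) := GRing.RMorphism.on (@poly3_of_mpoly L).
HB.instance Definition _ (L : fieldType) := GRing.RMorphism.on (@mpoly_of_poly3 L).

Lemma mpoly_rmorph_id (R : comNzRingType) (k : nat)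
    (f : {rmorphism {mpoly R[k]} -> {mpoly R[k]}}) :
  (forall c, f c%:MP = c%:MP) -> (forall i, f 'X_i = 'X_i) -> f =1 id.
Proof.
move=> fC fX p; rewrite [p in LHS]mpolyE [RHS]mpolyE rmorph_sum.
apply: eq_bigr => m _; rewrite -mul_mpolyC rmorphM /= fC mpolyXE_id rmorph_prod.
by congr (_ * _); apply: eq_bigr => i _; rewrite rmorphXn /= fX.
Qed.

Lemma poly3_of_mpolyK (L : fieldType) :
  cancel (@poly3_of_mpoly L) (@mpoly_of_poly3 L).
Proof.
apply: (@mpoly_rmorph_id _ _ (@mpoly_of_poly3 L \o @poly3_of_mpoly L)) => [c|i] /=.
  rewrite /poly3_of_mpoly mmapC /mpoly_of_poly3 /=.
  by do 3!rewrite ?map_polyC /=; rewrite /horner_eval !hornerC.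
rewrite /poly3_of_mpoly mmapX mmap1U /mpoly_of_poly3 /=.
by case: (ord3P i) => -> /=; do 3!rewrite ?map_polyC ?map_polyX /=;
  rewrite /horner_eval ?(hornerC, hornerX).
Qed.

Lemma poly3_of_mpoly_unit (L : fieldType) (A : {mpoly L[3]}) :
  A \is a GRing.unit -> poly3_of_mpoly A \is a GRing.unit.
Proof.
case/unitrP => B [BA AB]; apply/unitrP; exists (poly3_of_mpoly B).
by rewrite -!rmorphM BA AB rmorph1.
Qed.

Lemma mpoly_of_poly3_unit (L : fieldType) (A : {poly {poly {poly L}}}) :
  A \is a GRing.unit -> mpoly_of_poly3 A \is a GRing.unit.
Proof.
case/unitrP => B [BA AB]; apply/unitrP; exists (mpoly_of_poly3 B).
by rewrite -!rmorphM BA AB rmorph1.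
Qed.

(** Eisenstein at [Y] in [L[X][Y][Z]]: modulo [Y] only [X * Z ^ n.+1] survives, and the constant
    term [X ^ n.+1 * Y] is not divisible by [Y ^ 2]. Some factor is thus free of [Z], and
    primitivity makes it a unit. *)
Lemma hurwitz_irreducible (L : fieldType) (n : nat) :
  irreducible_mpoly (hurwitz L n.+1).
Proof.
set P := poly3_of_mpoly (hurwitz L n.+1).
have PE : P = ('X%:P)%:P * 'X^(n.+1) + ('X^(n.+1))%:P * 'X + ('X%:P ^+ n.+1 * 'X)%:P.
  rewrite /P /poly3_of_mpoly /hurwitz !rmorphD !rmorphM !rmorphXn /=.
  rewrite !mmapX !mmap1U /= -!rmorphXn -!rmorphM /=.
  by rewrite [LHS]addrC [X in X + _ = _]mulrC [X in _ + X = _]addrC addrA.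
have bP : map_poly (horner_eval 0) P = 'X *: 'X^(n.+1).
  rewrite PE !rmorphD !rmorphM /= !map_polyC map_polyX map_polyXn /= /horner_eval.
  by rewrite hornerC hornerXn hornerX expr0n polyC0 mulr0 mul0r !addr0 mul_polyC.
have X0 : ('X : {poly L}) != 0 by rewrite polyX_eq0.
have sP : (n.+1 < size P)%N.
  have : size (map_poly (horner_eval 0) P) = n.+2.
    by rewrite bP size_scale // size_polyXn.
  by move=> <-; apply: size_poly.
have sP' : (size P <= n.+2)%N.
  rewrite PE; apply/leq_sizeP => j nj.
  rewrite !coefD !coefCM coefXn coefX coefC !gtn_eqF ?mulr0 ?addr0 //; lia.
have c1 : (P`_0)`_1 != 0.
  rewrite PE !coefD !coefCM coefXn coefX /= !mulr0 coefC /= ?add0r ?coef0 ?add0r.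
  by rewrite mulr0 !add0r coefC /= coefMX /= -rmorphXn coefC expf_neq0.
split.
- by apply/eqP => F0; move: sP; rewrite /P F0 rmorph0 size_poly0.
- apply/negP => /poly3_of_mpoly_unit.
  by rewrite -/P poly_unitE => /andP[/eqP sP1]; move: sP; rewrite sP1.
move=> G H FGH; pose f := @poly3_of_mpoly L.
have PGH : P = f G * f H by rewrite /P FGH rmorphM.
have unitE A : size (f A) = 1%N -> (exists B, f A * B = P) -> A \is a GRing.unit.
  move=> sA [B AB]; rewrite -[A]poly3_of_mpolyK; apply: mpoly_of_poly3_unit.
  move: AB; rewrite -/f [f A]size1_polyC ?sA // PE; exact: constant_divisor_unit.
move: bP sP' c1; rewrite PGH => bP sP' c1.
case: (eisensteinX X0 bP sP' c1) => [s|s]; [left|right]; apply: unitE => //.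
  by exists (f H).
by exists (f G); rewrite mulrC.
Qed.

Lemma map_hurwitz (K L : fieldType) (f : {rmorphism K -> L}) (n : nat) :
  map_mpoly f (hurwitz K n) = hurwitz L n.
Proof. by rewrite /hurwitz !rmorphD !rmorphM !rmorphXn /= !map_mpolyX. Qed.

Lemma hurwitz_homog (K : fieldType) (n : nat) :
  hurwitz K n \is n.+1.-homog.
Proof.
have XE (i j : 'I_3) : ('X_i ^+ n * 'X_j : {mpoly K[3]}) \is n.+1.-homog.
  have X1 (k : 'I_3) : ('X_k : {mpoly K[3]}) \is 1.-homog by rewrite dhomogX /= mdeg1.
  by have := dhomogM (dhomogMn n (X1 i)) (X1 j); rewrite mul1n addn1.
by rewrite /hurwitz !dhomogD.
Qed.

End Irreducible.

(** * Non-singularity and maximality *)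

Section Nonsingular.
Import GRing.Theory.
Local Open Scope ring_scope.

Lemma mderivXU (R : nzRingType) (k : nat) (i j : 'I_k) :
  ('X_j : {mpoly R[k]})^`M(i) = (i == j)%:R.
Proof.
rewrite mderivX mnm1E eq_sym; case: eqP => [->|_]; last by rewrite scale0r.
rewrite scale1r -mpolyX0; congr 'X_[_].
by apply/mnmP => j'; rewrite mnmBE mnm0E subnn.
Qed.

Lemma mderiv_exp (R : comNzRingType) (k l : nat) (i : 'I_k) (f : {mpoly R[k]}) :
  (f ^+ l.+1)^`M(i) = l.+1%:R * f ^+ l * f^`M(i).
Proof.
elim: l => [|l IH]; first by rewrite expr0 !mul1r.
rewrite exprS mderivM IH [f ^+ l.+1]exprS -[l.+2]addn1 natrD.
by move: (f ^+ l) (f^`M(i)) => a b; ring.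
Qed.

Lemma meval_mderiv_monomial (R : comNzRingType) (k l : nat) (i j s : 'I_k)
    (v : 'I_k -> R) :
  (('X_i ^+ l.+1 * 'X_j)^`M(s)).@[v]
    = l.+1%:R * v i ^+ l * (s == i)%:R * v j + v i ^+ l.+1 * (s == j)%:R.
Proof.
rewrite mderivM mderiv_exp !mderivXU mevalD !mevalM !rmorphXn /=.
by rewrite !mevalXU !rmorph_nat.
Qed.

(** At a singular point, [F], [Y * F_Y] and [Z * F_Z] give linear relations between the values of
    the three monomials, and elimination brings out the factor [m = n * n.+1 + 1]. The monomials
    therefore vanish, and the partial derivatives spread the zeros to all coordinates. *)
Lemma hurwitz_nonsingular (K : fieldType) (n : nat) :
  (n * n.+1).+1%:R != 0 :> K -> nonsingular (hurwitz K n.+1).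
Proof.
move=> mK L f v v0; rewrite map_hurwitz meval_hurwitz => F0.
have mL : (n * n.+1).+1%:R != 0 :> L by rewrite -(rmorph_nat f) fmorph_eq0.
case: (pickP (fun i => ((hurwitz L n.+1)^`M(i)).@[v 0] != 0)) => [i di|dF].
  by exists i.
have dE i : ((hurwitz L n.+1)^`M(i)).@[v 0] = 0 by have /negbFE/eqP := dF i.
have := (dE 0, dE 1, dE 2); rewrite /hurwitz !mderivD !mevalD !meval_mderiv_monomial /=.
rewrite !mulr0 !mulr1 !mul0r !addr0 !add0r.
move: F0; set x := v 0 0; set y := v 0 1; set z := v 0 2 => F0 [[d0 d1] d2].
have C0 : z ^+ n.+1 * x = 0.
  (* The combination [F - Y * F_Y + n * Z * F_Z] equals [m * Z ^ n.+1 * X]. *)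
  apply: (mulfI mL); rewrite mulr0.
  transitivity (x ^+ n.+1 * y + y ^+ n.+1 * z + z ^+ n.+1 * x
      - y * (x ^+ n.+1 + n.+1%:R * y ^+ n * z)
      + n%:R * z * (y ^+ n.+1 + n.+1%:R * z ^+ n * x)).
    by rewrite -[(_ * _).+1]addn1 natrD natrM -[n.+1%:R]natr1 !exprS; ring.
  by rewrite F0 d1 d2 !mulr0 subr0 addr0.
have A0 : x ^+ n.+1 * y = 0.
  transitivity (y * (x ^+ n.+1 + n.+1%:R * y ^+ n * z)
      - n.+1%:R * (z * (y ^+ n.+1 + n.+1%:R * z ^+ n * x)
                   - n.+1%:R * (z ^+ n.+1 * x))).
    by rewrite !exprS; ring.
  by rewrite d1 d2 C0 !mulr0 subr0 mulr0 subr0.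
have exp0 (t : L) : t ^+ n.+1 = 0 -> t = 0 by move/eqP; rewrite expf_eq0 => /eqP.
case/eqP: v0; move/eqP: A0; rewrite mulf_eq0 expf_eq0 /= => /orP[/eqP x0|/eqP y0].
  have y0 : y = 0 by apply: exp0; move: d2; rewrite x0 mulr0 addr0.
  have z0 : z = 0 by apply: exp0; move: d0; rewrite y0 mulr0 add0r.
  by apply: row3P; rewrite mxE.
have z0 : z = 0 by apply: exp0; move: d0; rewrite y0 mulr0 add0r.
have x0 : x = 0 by apply: exp0; move: d1; rewrite z0 mulr0 addr0.
by apply: row3P; rewrite mxE.
Qed.

End Nonsingular.

(** * The point count that characterises maximality *)

Section Maximality.
Import GRing.Theory.
Local Open Scope ring_scope.

(** The equation on the left is maximality with the three coordinate points removed and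
    [2 * g = m.-1]. *)
Lemma card_kummer_points_maximal (K : finFieldType) (q r : nat)
    (m := (r * r.+1).+1) :
  [pchar K].-nat q -> (1 < q)%N -> #|K| = (q ^ 2)%N ->
  (#|kummer_points K r m| + 2 = q ^ 2 + q * m.-1)%N <-> (m %| q.+1)%N.
Proof.
move=> qp q1 cK.
have cr : coprime m r by rewrite coprime_sym /m /coprime -[(_ * _).+1]addn1 [(r * _)%N]mulnC gcdnMDl gcdn1.
have cr1 : coprime m r.+1.
  by rewrite coprime_sym /m /coprime -[(_ * _).+1]addn1 gcdnMDl gcdn1.
have Kq : (#|K|.-1 = q.-1 * q.+1)%N by rewrite cK; case: q q1 {qp cK} => // q _; nia.
have Q1 : (q ^ 2 = #|K|.-1 + 1)%N.
  by rewrite -cK addn1 prednK // ltnW // finNzRing_gt1.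
split=> [kE|mq].
  set d := gcdn m #|K|.-1.
  have dm : (d %| m)%N by apply: dvdn_gcdl.
  (* The fibre bound is applied with [x = m.-1], and the strict inequality leaves only [d = m]. *)
  have md : (m.-1 < d)%N.
    apply: (@line_fibre_bound K r q d); rewrite ?dvdn_gcdr ?(coprime_dvdl dm) //.
    by rewrite -kE leq_add2r kummer_points_le.
  have dE : d = m by apply/eqP; rewrite eqn_leq md dvdn_leq.
  have mK : (m %| #|K|.-1)%N by rewrite -dE dvdn_gcdr.
  have mk : (m %| #|kummer_points K r m|)%N by rewrite kummer_points_eq // dvdn_mulr.
  rewrite -(dvdn_addl _ mk).
  have -> : (q.+1 + #|kummer_points K r m| = #|K|.-1 + q * m)%N.
    by move: kE; rewrite Q1 /m /=; nia.
  by rewrite dvdn_add // dvdn_mull.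
have mK : (m %| #|K|.-1)%N by rewrite Kq dvdn_mull.
rewrite kummer_points_eq //.
have fE := hermitian_line_fibre r qp q1 cK mq.
set l := (q.+1 %/ m)%N in fE; have lE : (m * l = q.+1)%N by rewrite mulnC divnK.
have lK : (m * l %| #|K|.-1)%N by rewrite lE Kq dvdn_mull.
have := card_unity_pairs lK cr cr1; rewrite lE => pE.
(* Multiplying by [m] replaces [m * l] by [q.+1], so that [l] disappears from the count. *)
have {}pE : (m * #|unity_pairs K q.+1 r l| + 3 * q.+1 = q.+1 * q.+1 + 2 * m)%N.
  transitivity (m * (#|unity_pairs K q.+1 r l| + 3 * l))%N.
    by rewrite mulnDr mulnCA lE.
  by rewrite pE mulnDr mulnCA lE [(m * 2)%N]mulnC.
move: fE pE; rewrite -mulnn; move: #|line_fibre _ _ _| #|unity_pairs _ _ _ _| => N G.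
have -> : m = m.-1.+1 by []. 
move: m.-1 => k fE pE.
have : (k.+1 * (N + 2) = k.+1 * (q + G))%N by rewrite fE.
by lia.
Qed.

End Maximality.

Theorem theorem3p1 (p q n : nat) (K : finFieldType)
    (p_prime : prime p) (q_pow : exists2 e : nat, 0 < e & q = p ^ e)
    (cardK : #|K| = q ^ 2) (n_gt0 : 0 < n)
    (p_ndvd : ~~ (p %| n ^ 2 - n + 1)) :
  maximal_curve q (hurwitz K n) <-> q + 1 = 0 %[mod n ^ 2 - n + 1].
Proof.
(* With [n = r.+1] the modulus becomes [r * r.+1 + 1], free of truncated subtraction. *)
case: n n_gt0 p_ndvd => // r _.
have -> : r.+1 ^ 2 - r.+1 + 1 = (r * r.+1).+1 by rewrite addn1 -mulnn mulSn addKn.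
move=> p_ndvd; have [e e0 qE] := q_pow.
have pK : p \in [pchar K]%R.
  by apply: (@card_finPcharP _ _ (e * 2)) => //; rewrite cardK qE -expnM.
have qK : [pchar K]%R.-nat q by rewrite qE pnatX pnatE ?pK.
have q1 : 1 < q by rewrite qE -(exp1n e) ltn_exp2r // prime_gt1.
have [F0 _ _] := hurwitz_irreducible K r.
have count := card_kummer_points_maximal r qK q1 cardK.
have -> : q + 1 = 0 %[mod (r * r.+1).+1] <-> (r * r.+1).+1 %| q.+1.
  by rewrite addn1 mod0n; split => /eqP.
have genusE g : 2 * g = r.+1 * r -> q * (r * r.+1) = 2 * q * g.
  by move=> gE; rewrite [r * _]mulnC -gE mulnCA mulnA.
rewrite -count; split=> [[_ _ _ [g /(has_genusP _ (hurwitz_homog K r.+1) F0) gE]]|cE].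
  rewrite card_hurwitz_points => kE.
  by rewrite /= (genusE _ gE); move: kE; move: #|kummer_points _ _ _| => k; lia.
(* A product of consecutive integers is even, so the genus is an integer. *)
have [g gE] : exists g, 2 * g = r.+1 * r.
  by exists (r.+1 * r)./2; rewrite mul2n -[RHS]odd_double_half oddM /= andNb.
split.
- by exists r.+2; apply: hurwitz_homog.
- by move=> L f; rewrite map_hurwitz; apply: hurwitz_irreducible.
- by apply: hurwitz_nonsingular; rewrite -(GRing.dvdn_pcharf pK).
exists g; first exact/(has_genusP _ (hurwitz_homog K r.+1) F0).
move: cE; rewrite card_hurwitz_points /= (genusE _ gE).
by move: #|kummer_points _ _ _| => k; lia.
Qed.
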